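(* Let $m\ge1$. For each $\alpha\in[0,m]$, the set $A_\alpha=\{E\in\chi(\mathbb{R}^m):\dim_{\mathcal{A}}E=\alpha\}$ is dense in $\chi(\mathbb{R}^m)$.
   Context: $\chi(\mathbb{R}^m)$ is the collection of all nonempty compact subsets of $\mathbb{R}^m$, equipped with the Hausdorff metric $\mathfrak{H}$ induced by the Euclidean norm. The Assouad dimension of a nonempty set $E\subseteq\mathbb{R}^m$ is $$\dim_{\mathcal{A}}E=\inf\Big\{\beta\ge0:\ \exists\, C>0\text{ such that for all }0<r<R\text{ and }x\in E,\ N_r(B(x,R)\cap E)\le C\Big(\frac{R}{r}\Big)^\beta\Big\},$$ where $B(x,R)=\{y\in\mathbb{R}^m:\|y-x\|_2\le R\}$ and $N_r(F)$ is the smallest number of open sets of diameter at most $r$ needed to cover $F$. *)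

(* Defs.v *)
From HB Require Import structures.
From mathcomp Require Import all_boot all_order all_algebra.
From mathcomp Require Import ring.
From mathcomp Require Import all_classical all_reals all_analysis.

Set Implicit Arguments.
Unset Strict Implicit.
Unset Printing Implicit Defensive.

Import Order.TTheory GRing.Theory Num.Theory.
Import numFieldNormedType.Exports.

Local Open Scope classical_set_scope.
Local Open Scope ring_scope.

(* The library norm on 'rV[R]_m is the sup norm: it induces the Euclidean
   topology (so [open] and [compact] can be used as they are) but not the
   Euclidean distance. *)
Definition l2norm (R : realType) (m : nat) (x : 'rV[R]_m) : R :=
  Num.sqrt (\sum_(i < m) x ord0 i ^+ 2).

Definition l2dist (R : realType) (m : nat) (x y : 'rV[R]_m) : R :=
  l2norm (x - y).

Definition l2ball (R : realType) (m : nat) (x : 'rV[R]_m) (r : R) :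
  set 'rV[R]_m := [set y | l2dist y x <= r].

(* Equal to -oo on set0, so that set0 has diameter at most r for all r. *)
Definition diameter (R : realType) (m : nat) (U : set 'rV[R]_m) : \bar R :=
  ereal_sup [set (l2dist p.1 p.2)%:E | p in U `*` U].

(* Equal to +oo if there is no finite cover. *)
Definition covering_number (R : realType) (m : nat) (r : R)
    (F : set 'rV[R]_m) : \bar R :=
  ereal_inf [set (n%:R)%:E | n in [set n : nat |
    exists U : 'I_n -> set 'rV[R]_m,
      (forall i, open (U i) /\ (diameter (U i) <= r%:E)%E) /\
      F `<=` \bigcup_i U i]].

Definition assouad_dim (R : realType) (m : nat) (E : set 'rV[R]_m) : \bar R :=
  ereal_inf [set b%:E | b in [set b : R | 0 <= b /\
    exists2 C : R, 0 < C & forall r s : R, 0 < r -> r < s ->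
      forall x, E x ->
      (covering_number r (l2ball x s `&` E) <= (C * (s / r) `^ b)%:E)%E]].

Definition infdist (R : realType) (m : nat) (x : 'rV[R]_m)
  (A : set 'rV[R]_m) : R := inf [set l2dist x y | y in A].

Definition excess (R : realType) (m : nat) (A B : set 'rV[R]_m) : R :=
  sup [set infdist x B | x in A].

Definition hausdorff_dist (R : realType) (m : nat) (A B : set 'rV[R]_m) : R :=
  Num.max (excess A B) (excess B A).

Record compacts (R : realType) (m : nat) := Compacts {
  compacts_set :> set 'rV[R]_m ;
  compacts_compact : compact compacts_set ;
  compacts_neq0 : compacts_set !=set0 }.

Lemma compacts_inj (R : realType) (m : nat) :
  injective (@compacts_set R m).
Proof.
move=> [A cA A0] [B cB B0] /= AB; subst B.
by congr Compacts; exact: Prop_irrelevance.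
Qed.

Section l2norm_lemmas.
Context {R : realType} {m : nat}.
Implicit Types x y z : 'rV[R]_m.

Lemma l2norm_ge0 x : 0 <= l2norm x.
Proof. exact: sqrtr_ge0. Qed.

Lemma sqr_l2norm x : l2norm x ^+ 2 = \sum_(i < m) x ord0 i ^+ 2.
Proof. by rewrite sqr_sqrtr// sumr_ge0// => i _; exact: sqr_ge0. Qed.

Lemma l2norm_eq0 x : l2norm x = 0 -> x = 0.
Proof.
move=> x0; have := sqr_l2norm x; rewrite x0 expr0n/= => /esym/eqP.
rewrite psumr_eq0; last by move=> i _; exact: sqr_ge0.
move=> /allP xi0; apply/rowP => i; rewrite mxE.
by have := xi0 i (mem_index_enum i); rewrite /= sqrf_eq0 => /eqP.
Qed.

Lemma l2norm0 : l2norm (0 : 'rV[R]_m) = 0.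
Proof.
rewrite /l2norm big1 ?sqrtr0// => i _.
by rewrite mxE expr0n.
Qed.

Lemma l2normN x : l2norm (- x) = l2norm x.
Proof. by congr Num.sqrt; apply: eq_bigr => i _; rewrite mxE sqrrN. Qed.

Lemma l2norm_cauchy_schwarz x y :
  \sum_(i < m) x ord0 i * y ord0 i <= l2norm x * l2norm y.
Proof.
have [/eqP/l2norm_eq0 ->|x0] := boolP (l2norm x == 0).
  by rewrite l2norm0 mul0r big1// => i _; rewrite mxE mul0r.
have [/eqP/l2norm_eq0 ->|y0] := boolP (l2norm y == 0).
  by rewrite l2norm0 mulr0 big1// => i _; rewrite mxE mulr0.
set a := l2norm x; set b := l2norm y.
have a0 : 0 < a by rewrite lt_neqAle eq_sym x0 l2norm_ge0.
have b0 : 0 < b by rewrite lt_neqAle eq_sym y0 l2norm_ge0.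
have ab0 : 0 < 2 * (a * b) by rewrite !mulr_gt0.
suff H : \sum_(i < m) (2 * (a * b)) * (x ord0 i * y ord0 i) <=
    2 * (a * b) * (a * b) by rewrite -mulr_sumr ler_pM2l in H.
apply: (@le_trans _ _
    (\sum_(i < m) (b ^+ 2 * x ord0 i ^+ 2 + a ^+ 2 * y ord0 i ^+ 2))).
  apply: ler_sum => i _; rewrite -subr_ge0.
  set u := x _ _; set v := y _ _.
  have -> : b ^+ 2 * u ^+ 2 + a ^+ 2 * v ^+ 2 - 2 * (a * b) * (u * v) =
    (b * u - a * v) ^+ 2 by ring.
  exact: sqr_ge0.
rewrite big_split/= -!mulr_sumr -!sqr_l2norm -/a -/b le_eqVlt.
by apply/orP; left; apply/eqP; ring.
Qed.

Lemma ler_l2normD x y : l2norm (x + y) <= l2norm x + l2norm y.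
Proof.
rewrite -(@ler_pXn2r _ 2%N) ?nnegrE ?addr_ge0 ?l2norm_ge0//.
rewrite sqr_l2norm sqrrD !sqr_l2norm.
have -> : \sum_(i < m) (x + y) ord0 i ^+ 2 = \sum_(i < m) x ord0 i ^+ 2 +
    (\sum_(i < m) x ord0 i * y ord0 i) *+ 2 + \sum_(i < m) y ord0 i ^+ 2.
  rewrite -sumrMnl -!big_split/=; apply: eq_bigr => i _.
  by rewrite mxE sqrrD.
by rewrite lerD2r lerD2l ler_pMn2r// l2norm_cauchy_schwarz.
Qed.

Lemma l2dist_ge0 x y : 0 <= l2dist x y.
Proof. exact: l2norm_ge0. Qed.

Lemma l2distxx x : l2dist x x = 0.
Proof. by rewrite /l2dist subrr l2norm0. Qed.

Lemma l2dist_sym x y : l2dist x y = l2dist y x.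
Proof. by rewrite /l2dist -l2normN opprB. Qed.

Lemma l2dist_triangle y x z : l2dist x z <= l2dist x y + l2dist y z.
Proof. by rewrite /l2dist (le_trans _ (ler_l2normD _ _))// addrA subrK. Qed.

Lemma l2dist_eq0 x y : l2dist x y = 0 -> x = y.
Proof. by move/l2norm_eq0/eqP; rewrite subr_eq0 => /eqP. Qed.

Lemma l2dist_continuous x : continuous (l2dist x).
Proof.
move=> y; rewrite /l2dist /l2norm.
apply: (@continuous_comp _ _ _ (fun y => \sum_(i < m) (x - y) ord0 i ^+ 2)).
  apply: (@continuous_big R _ +%R 0 _ add_continuous _ _
    (fun i (y : 'rV[R]_m) => (x - y) ord0 i ^+ 2)) => i _ z.
  have coordB : (fun t : 'rV[R]_m => x ord0 i - t ord0 i) t @[t --> z] -->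
      x ord0 i - z ord0 i.
    exact: (cvgB (cvg_cst _) (@coord_continuous R 1 m ord0 i z)).
  rewrite (_ : (fun _ => _) =
    (fun t : 'rV[R]_m => (x ord0 i - t ord0 i) * (x ord0 i - t ord0 i))).
    by apply: (@cvgM _ _ _ _ _ _ _ _ coordB coordB).
  by apply/funext => t; rewrite !mxE expr2.
exact: sqrt_continuous.
Qed.

End l2norm_lemmas.

Section hausdorff_dist_lemmas.
Context {R : realType} {m : nat}.
Implicit Types (A B C : compacts R m) (x y : 'rV[R]_m).

Lemma infdist_le x A y : compacts_set A y -> infdist x A <= l2dist x y.
Proof.
move=> Ay; apply: ge_inf; last by exists y.
by exists 0 => _ [z _ <-]; exact: l2dist_ge0.
Qed.

Lemma infdist_ge x A (d : R) :
  (forall y, compacts_set A y -> d <= l2dist x y) -> d <= infdist x A.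
Proof.
move=> h; apply: lb_le_inf; first exact/image_nonempty/compacts_neq0.
by move=> _ [y Ay <-]; exact: h.
Qed.

Lemma infdist_ge0 x A : 0 <= infdist x A.
Proof. by apply: infdist_ge => y _; exact: l2dist_ge0. Qed.

Lemma infdist_mem x A : exists2 y, compacts_set A y & infdist x A = l2dist x y.
Proof.
have [|y] := @compact_EVT_min _ R (l2dist x) A (compacts_neq0 A)
  (compacts_compact (c := A)).
  by apply: continuous_subspaceT => y; exact: l2dist_continuous.
rewrite inE => Ay ymin; exists y => //; apply/eqP.
rewrite eq_le infdist_le//=; apply: infdist_ge => z Az.
by apply: ymin; rewrite inE.
Qed.

Lemma excess_has_ub A B : has_ubound [set infdist x B | x in A].
Proof.
have [b Bb] := compacts_neq0 B.
have [|y] := @compact_EVT_max _ R (l2dist b) A (compacts_neq0 A)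
  (compacts_compact (c := A)).
  by apply: continuous_subspaceT => y; exact: l2dist_continuous.
move=> _ ymax; exists (l2dist b y) => _ [x Ax <-].
rewrite (le_trans (infdist_le x Bb))// l2dist_sym.
by apply: ymax; rewrite inE.
Qed.

Lemma excess_ge A B x : compacts_set A x -> infdist x B <= excess A B.
Proof. by move=> Ax; apply: ub_le_sup; [exact: excess_has_ub|exists x]. Qed.

Lemma excess_le A B (d : R) :
  (forall x, compacts_set A x -> infdist x B <= d) -> excess A B <= d.
Proof.
move=> h; apply: ge_sup; first exact/image_nonempty/compacts_neq0.
by move=> _ [x Ax <-]; exact: h.
Qed.

Lemma excess_ge0 A B : 0 <= excess A B.
Proof.
have [a Aa] := compacts_neq0 A.
exact: le_trans (infdist_ge0 a B) (excess_ge B Aa).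
Qed.

Lemma excess_eq0 A B : excess A B <= 0 -> A `<=` B.
Proof.
move=> AB0 x Ax; have [y By xy] := infdist_mem x B.
suff /l2dist_eq0 -> : l2dist x y = 0 by [].
apply/eqP; rewrite eq_le l2dist_ge0 andbT -xy.
exact: le_trans (excess_ge _ Ax) AB0.
Qed.

Lemma excess_triangle B A C : excess A C <= excess A B + excess B C.
Proof.
apply: excess_le => x Ax; have [y By xy] := infdist_mem x B.
have [z Cz yz] := infdist_mem y C.
rewrite (le_trans (infdist_le _ Cz))// (le_trans (l2dist_triangle y _ _))//.
by rewrite -xy -yz lerD// excess_ge.
Qed.

Lemma hausdorff_distxx A : hausdorff_dist A A = 0.
Proof.
rewrite /hausdorff_dist maxxx; apply/eqP; rewrite eq_le excess_ge0 andbT.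
by apply: excess_le => x Ax; rewrite (le_trans (infdist_le _ Ax))// l2distxx.
Qed.

Lemma hausdorff_dist_sym A B : hausdorff_dist A B = hausdorff_dist B A.
Proof. by rewrite /hausdorff_dist maxC. Qed.

Lemma hausdorff_dist_eq0 A B : hausdorff_dist A B = 0 -> A = B.
Proof.
move=> AB; have : hausdorff_dist A B <= 0 by rewrite AB.
rewrite /hausdorff_dist ge_max => /andP[h1 h2].
by apply: compacts_inj; apply/seteqP; split; exact: excess_eq0.
Qed.

Lemma hausdorff_dist_triangle B A C :
  hausdorff_dist A C <= hausdorff_dist A B + hausdorff_dist B C.
Proof.
rewrite /hausdorff_dist ge_max; apply/andP; split.
  by rewrite (le_trans (excess_triangle B A C))// lerD// le_max lexx.
rewrite (le_trans (excess_triangle B C A))// addrC.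
by rewrite lerD// le_max lexx orbT.
Qed.

End hausdorff_dist_lemmas.

HB.instance Definition _ (R : realType) (m : nat) :=
  gen_eqMixin (compacts R m).
HB.instance Definition _ (R : realType) (m : nat) :=
  gen_choiceMixin (compacts R m).
HB.instance Definition _ (R : realType) (m : nat) :=
  @isMetric.Build R (compacts R m)
    (fun A B => hausdorff_dist A B)
    hausdorff_distxx hausdorff_dist_eq0 hausdorff_dist_sym
    hausdorff_dist_triangle.

(* Main.v *)
(** Every compact set is approximated by a finite net of itself, and adding to
    the net a tiny compact set of Assouad dimension [alpha] gives a set of
    dimension [alpha]. Such a set is the [m]-fold power of the central Cantor set
    of ratio [lam = 2 `^ (- m / alpha)], which is at most [1 / 2] because
    [alpha <= m]: its [2 ^ (m * l)] cells [l] levels further down are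
    [lam ^+ l] times smaller, and [2 ^ (m * l) = (lam^-1 ^+ l) `^ alpha].
    For [alpha = 0] a single point is enough. *)

Require Import Defs.
From mathcomp Require Import all_boot all_order all_algebra.
From mathcomp Require Import all_classical all_reals all_analysis.
From mathcomp Require Import zify ring lra.
Set Implicit Arguments.
Unset Strict Implicit.
Unset Printing Implicit Defensive.
Import Order.TTheory GRing.Theory Num.Theory.
Import numFieldNormedType.Exports.
Local Open Scope classical_set_scope.
Local Open Scope ring_scope.

(** * Central Cantor sets on the line *)

Section CantorSet.
Context {R : realType} (lam d : R).

(* The left endpoint of the [j]-th interval of level [n] of a Cantor set built on
   [[0, d]]. Starting from all the intervals [[d j, d (j + 1)]] rather than from
   [j = 0] alone lets [j] range over all of [nat] without boundary cases. *)
Fixpoint node (n j : nat) : R :=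
  if n is n'.+1 then node n' j./2 + (odd j)%:R * ((1 - lam) * (d * lam ^+ n'))
  else d * j%:R.

Definition cell (a : R) (n j : nat) : set R :=
  [set` `[a + node n j, a + node n j + d * lam ^+ n]].

Definition cantor (a : R) : set R :=
  [set x | forall n, exists2 j, (j < 2 ^ n)%N & cell a n j x].

Hypotheses (lam_gt0 : 0 < lam) (lam_le_half : 2 * lam <= 1) (d_gt0 : 0 < d).

Let lam_lt1 : lam < 1.
Proof. by have := lam_gt0; have := lam_le_half; lra. Qed.

Lemma width_gt0 n : 0 < d * lam ^+ n.
Proof. by rewrite mulr_gt0// exprn_gt0. Qed.

Lemma width_le n k : (n <= k)%N -> d * lam ^+ k <= d * lam ^+ n.
Proof. by move=> nk; rewrite ler_pM2l// ler_wiXn2l// ltW. Qed.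

Lemma cellP a n j x :
  cell a n j x <-> a + node n j <= x <= a + node n j + d * lam ^+ n.
Proof. by rewrite /cell /= in_itv. Qed.

(** Siblings do not overlap because [2 * lam <= 1]. A right child ends where its parent ends, so the
    next cell, which has another parent, is handled by induction. *)
Lemma node_step n j : node n j + d * lam ^+ n <= node n j.+1.
Proof.
elim: n j => [|n IH] j /=.
  by rewrite expr0 mulr1 -natr1 mulrDr mulr1.
have w0 := width_gt0 n; have := IH j./2.
rewrite uphalf_half exprSr (mulrA d); set w := d * lam ^+ n in w0 *.
case: (odd j) => /= h; rewrite ?add0n ?add1n !(mul0r, mul1r, addr0).
  have : (1 - lam) * w + w * lam = w by ring.
  by lra.
rewrite lerD2l; have : (2 * lam) * w <= 1 * w by rewrite ler_wpM2r// ltW.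
by rewrite mulrBl mul1r -mulrA (mulrC w); lra.
Qed.

Lemma node_lb n j k : node n j + d * lam ^+ n * k%:R <= node n (j + k).
Proof.
elim: k => [|k IH]; first by rewrite mulr0 addr0 addn0.
rewrite addnS (le_trans _ (node_step _ _))//.
by rewrite -natr1 mulrDr mulr1 addrA lerD2r.
Qed.

Lemma node_sep n i j : i != j -> d * lam ^+ n <= `|node n i - node n j|.
Proof.
wlog ij : i j / (i < j)%N.
  move=> H; case: (ltngtP i j) => // ij _; first by apply: H => //; lia.
  by rewrite distrC; apply: H => //; lia.
move=> _; rewrite distrC; apply: le_trans (ler_norm _).
have := node_lb n i (j - i); rewrite (subnKC (ltnW ij)).
rewrite lerBrDl; apply: le_trans; rewrite lerD2l.
apply: ler_peMr; first exact/ltW/width_gt0.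
by rewrite ler1n subn_gt0.
Qed.

Lemma cell_parent a n j : cell a n.+1 j `<=` cell a n j./2.
Proof.
move=> x /cellP/= /andP[h1 h2]; apply/cellP.
have w0 := width_gt0 n; move: h1 h2; rewrite exprSr (mulrA d).
set w := d * lam ^+ n in w0 *.
have : 0 <= (1 - lam) * w by rewrite mulr_ge0 ?ltW// subr_gt0.
have : 0 <= w * lam by rewrite mulr_ge0 ?ltW.
have : w * lam + (1 - lam) * w = w by ring.
case: (odd j); rewrite ?(mul0r, mul1r) => *; lra.
Qed.

Lemma cell_ancestor a n k j : cell a (n + k) j `<=` cell a n (j %/ 2 ^ k).
Proof.
elim: k j => [|k IH] j; first by rewrite addn0 expn0 divn1.
rewrite addnS; apply: subset_trans (@cell_parent _ _ _) _.
by rewrite expnS divnMA divn2; exact: IH.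
Qed.

Lemma node_descendant n k j : node (n + k) (j * 2 ^ k) = node n j.
Proof.
elim: k j => [|k IH] j; first by rewrite addn0 expn0 muln1.
by rewrite addnS expnS mulnCA mul2n /= odd_double doubleK mul0r addr0.
Qed.

Lemma node_mem_cell a n j : cell a n j (a + node n j).
Proof. by apply/cellP; rewrite lexx lerDl ltW// width_gt0. Qed.

(** At deeper levels the endpoint is that of the leftmost descendant; at coarser levels it lies in
    the ancestor cell. *)
Lemma cantor_node a n j : (j < 2 ^ n)%N -> cantor a (a + node n j).
Proof.
move=> jn k; have [nk|kn] := leqP n k.
  exists (j * 2 ^ (k - n))%N.
    by rewrite -{2}(subnKC nk) expnD ltn_pmul2r ?expn_gt0.
  rewrite -[X in a + X](@node_descendant n (k - n)) subnKC//.
  exact: node_mem_cell.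
exists (j %/ 2 ^ (n - k))%N.
  by rewrite ltn_divLR ?expn_gt0// -expnD subnKC// ltnW.
by apply: cell_ancestor; rewrite (subnKC (ltnW kn)); exact: node_mem_cell.
Qed.

Lemma cantor_base a : cantor a a.
Proof.
by rewrite -[a in cantor _ a]addr0 -(mulr0 d); exact: (@cantor_node a 0 0).
Qed.

Lemma cantor_le a x : cantor a x -> a <= x <= a + d.
Proof.
by move=> /(_ 0%N)[[|//] _ /cellP/=]; rewrite expr0 mulr0 mulr1 addr0.
Qed.

Lemma cantor_compact a : compact (cantor a).
Proof.
apply: (@subclosed_compact _ _ [set` `[a, a + d]]).
- rewrite (_ : cantor a = \bigcap_(n in [set: nat])
      \big[setU/set0]_(j <- iota 0 (2 ^ n)) cell a n j).
    apply: closed_bigI => n _; apply: closed_bigsetU => j _.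
    exact: interval_closed.
  apply/seteqP; split => x h n; last first.
    have := h n I; rewrite -bigcup_seq => -[j /=].
    by rewrite mem_iota add0n => jn xj; exists j.
  by move=> _; have [j jn xj] := h n; rewrite -bigcup_seq; exists j;
    rewrite //= mem_iota.
- exact: segment_compact.
- by move=> x /cantor_le; rewrite /= in_itv.
Qed.

(** If [j >= i + 3], then [node_lb] leaves a gap of at least two widths between the cells. *)
Lemma cell_close a n i j x y : cell a n i x -> cell a n j y ->
  `|x - y| <= d * lam ^+ n -> (j <= i + 2)%N.
Proof.
move=> /cellP/andP[x1 x2] /cellP/andP[y1 y2]; rewrite ler_distl => /andP[h1 h2].
rewrite leqNgt; apply/negP => ij.
have := node_lb n i (j - i); rewrite subnKC; last lia.
have : (3 : R) <= (j - i)%:R by rewrite ler_nat; lia.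
have := width_gt0 n; set w := d * _ in x2 y2 h1 h2 * => w0 h3 h4.
have : w * 3 <= w * (j - i)%:R by rewrite ler_pM2l.
by lra.
Qed.

(* Only five cells of level [n] can meet a ball of radius [d * lam ^+ n] around
   [x], and each of them has [2 ^ l] descendants at level [n + l]. *)
Lemma cantor_local_cover a n l x : cantor a x ->
  exists j0 : nat, forall y, cantor a y ->
    n = 0%N \/ `|x - y| <= d * lam ^+ n ->
    exists v : 'I_5 * 'I_(2 ^ l),
      `|a + node (n + l) ((j0 + v.1 - 2) * 2 ^ l + v.2)%N - y|
        <= d * lam ^+ (n + l).
Proof.
move=> /(_ n)[j0 j0n xj0]; exists j0 => y /(_ (n + l)%N)[j jnl yj] xy.
have yn := cell_ancestor yj; set i := (j %/ 2 ^ l)%N in yn.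
have i_lt : (i < 2 ^ n)%N by rewrite ltn_divLR ?expn_gt0// -expnD.
have [h1 h2] : (i <= j0 + 2)%N /\ (j0 <= i + 2)%N.
  case: xy => [n0|xy]; last first.
    split; first exact: cell_close xj0 yn xy.
    by apply: cell_close yn xj0 _; rewrite distrC.
  by move: i_lt j0n; rewrite n0 expn0; lia.
have i5 : (i + 2 - j0 < 5)%N by lia.
have jl : (j %% 2 ^ l < 2 ^ l)%N by rewrite ltn_mod expn_gt0.
(* The first component is the offset [i - j0], between -2 and 2, shifted by 2 to be a natural
   number; the second is the rank of [j] among the descendants of [i]. *)
exists (Ordinal i5, Ordinal jl) => /=.
rewrite (_ : (j0 + (i + 2 - j0) - 2)%N = i); last lia.
rewrite -divn_eq; move: yj => /cellP/andP[y1 y2].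
by rewrite distrC ger0_norm ?subr_ge0// lerBlDl.
Qed.

End CantorSet.

(** * Covering numbers, Assouad dimension and finite nets *)

Section Covering.
Context {R : realType} {m : nat}.
Implicit Types (x y z : 'rV[R]_m) (A B F : set 'rV[R]_m).

Lemma l2norm_le_coord x (t : R) : 0 <= t ->
  (forall i, `|x ord0 i| <= t) -> l2norm x <= m%:R * t.
Proof.
move=> t0 xt; have mt0 : 0 <= m%:R * t by rewrite mulr_ge0.
rewrite -(@ler_pXn2r _ 2%N) ?nnegrE ?l2norm_ge0// sqr_l2norm.
apply: (@le_trans _ _ (\sum_(i < m) t ^+ 2)).
  by apply: ler_sum => i _; rewrite -real_normK ?num_real// lerXn2r ?nnegrE.
rewrite sumr_const card_ord -[leLHS]mulr_natl exprMn ler_wpM2r ?sqr_ge0//.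
by rewrite -natrX ler_nat; case: m => // k; rewrite leq_pmulr.
Qed.

Lemma coord_le_l2norm x i : `|x ord0 i| <= l2norm x.
Proof.
rewrite -(@ler_pXn2r _ 2%N) ?nnegrE ?l2norm_ge0// sqr_l2norm.
rewrite real_normK ?num_real// (bigD1 i)//= lerDl.
by apply: sumr_ge0 => j _; exact: sqr_ge0.
Qed.

Lemma open_l2dist_lt x (t : R) : open [set y | l2dist x y < t].
Proof.
apply: (@open_comp _ _ (l2dist x) [set u : R | u < t]); last exact: open_lt.
by move=> y _; exact: l2dist_continuous.
Qed.

Lemma covering_number_le (r : R) F (p : seq 'rV[R]_m) :
  (forall y, F y -> exists2 z, z \in p & l2dist z y < r / 2) ->
  (covering_number r F <= (size p)%:R%:E)%E.
Proof.
move=> pF; apply: ereal_inf_lbound; exists (size p) => //.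
exists (fun i => [set y | l2dist (nth 0 p i) y < r / 2]); split.
  move=> i; split; first exact: open_l2dist_lt.
  apply: ge_ereal_sup => _ [[y z] /= [yi zi] <-]; rewrite lee_fin.
  rewrite (le_trans (l2dist_triangle (nth 0 p i) _ _))// l2dist_sym.
  by rewrite ltW// [ltRHS]splitr ltrD.
move=> y /pF[z zp zy]; have zi : (index z p < size p)%N by rewrite index_mem.
by exists (Ordinal zi) => //=; rewrite nth_index.
Qed.

(** Pigeonhole: a set of diameter at most [r] contains at most one of the points, so assigning to
    each point a covering set is injective. *)
Lemma covering_number_ge (r : R) F (T : finType) (q : T -> 'rV[R]_m) :
  (forall t, F (q t)) -> (forall t u, t != u -> r < l2dist (q t) (q u)) ->
  ((#|T|)%:R%:E <= covering_number r F)%E.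
Proof.
move=> qF qsep; apply: le_ereal_inf_tmp => _ [n [U [Uop FU]] <-].
rewrite lee_fin ler_nat.
have /choice[f fU] : forall t, exists i, U i (q t).
  by move=> t; have [i _ Ui] := FU _ (qF t); exists i.
rewrite -[leqRHS]card_ord; apply: (@leq_card _ _ f) => t u ftu.
apply/eqP/negPn/negP => /qsep; apply/negP; rewrite -leNgt -lee_fin.
apply: le_trans (Uop (f t)).2; apply: ereal_sup_ubound.
by exists (q t, q u) => //=; split => /=; [exact: fU | rewrite ftu; exact: fU].
Qed.

Lemma covering_number_sub (r : R) A B : A `<=` B ->
  (covering_number r A <= covering_number r B)%E.
Proof.
move=> AB; apply: le_ereal_inf => _ [n [U [Uop BU]] <-].
by exists n => //; exists U; split => //; exact: subset_trans BU.
Qed.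

Lemma assouad_dim_sub A B : A `<=` B -> (assouad_dim A <= assouad_dim B)%E.
Proof.
move=> AB; apply: le_ereal_inf => _ [b [b0 [C C0 hC]] <-].
exists b => //; split => //; exists C => // r s r0 rs x /AB Bx.
by apply: le_trans (hC _ _ r0 rs _ Bx); apply: covering_number_sub; exact: setIS.
Qed.

Lemma assouad_dim_ge0 A : (0 <= assouad_dim A)%E.
Proof. by apply: le_ereal_inf_tmp => _ [b [b0 _] <-]; rewrite lee_fin. Qed.

(* Unlike in [assouad_dim], the centre [x] need not lie in [A]; this makes the
   property stable under unions. *)
Definition homogeneous (alpha : R) A := exists2 C : R, 0 < C &
  forall r s x, 0 < r -> r < s -> exists2 p : seq 'rV[R]_m,
    (forall y, A y -> l2dist y x <= s -> exists2 z, z \in p & l2dist z y < r / 2)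
    & (size p)%:R <= C * (s / r) `^ alpha.

Lemma homogeneousU (alpha : R) A B :
  homogeneous alpha A -> homogeneous alpha B -> homogeneous alpha (A `|` B).
Proof.
move=> [C C0 hA] [D D0 hB]; exists (C + D); first exact: addr_gt0.
move=> r s x r0 rs; have [p pA ps] := hA r s x r0 rs.
have [q qB qs] := hB r s x r0 rs.
exists (p ++ q); last by rewrite size_cat natrD mulrDl lerD.
move=> y [Ay|By] yx; [have [z zp zy] := pA _ Ay yx|have [z zp zy] := qB _ By yx];
  by exists z => //; rewrite mem_cat zp ?orbT.
Qed.

Lemma homogeneous_seq (alpha : R) (u : seq 'rV[R]_m) : 0 <= alpha ->
  homogeneous alpha [set` u].
Proof.
(* The added 1 keeps the constant positive when [u] is empty. *)
move=> a0; exists ((size u)%:R + 1); first by rewrite ltr_wpDl.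
move=> r s x r0 rs; exists u.
  by move=> y uy _; exists y => //; rewrite l2distxx divr_gt0.
have : 1 <= (s / r) `^ alpha.
  rewrite -(powRr0 (s / r)); apply: ler_powR => //.
  by rewrite ler_pdivlMr// mul1r ltW.
set t := _ `^ _ => t1; rewrite (@le_trans _ _ ((size u)%:R * t))//.
  by rewrite ler_peMr.
by rewrite ler_wpM2r ?(le_trans _ t1)// lerDl.
Qed.

Lemma homogeneous_assouad_dim_le (alpha : R) A : 0 <= alpha ->
  homogeneous alpha A -> (assouad_dim A <= alpha%:E)%E.
Proof.
move=> a0 [C C0 hA]; apply: ereal_inf_lbound; exists alpha => //; split => //.
exists C => // r s r0 rs x _; have [p pA ps] := hA r s x r0 rs.
apply: (@le_trans _ _ (size p)%:R%:E); last by rewrite lee_fin.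
by apply: covering_number_le => y [yx Ay]; exact: pA.
Qed.

Lemma compact_finite_net A (e : R) : compact A -> 0 < e ->
  exists2 u : seq 'rV[R]_m, (forall y, y \in u -> A y) &
    forall x, A x -> exists2 y, y \in u & l2dist x y < e.
Proof.
rewrite compact_cover => cA e0.
have [||D DA AD] := cA _ A (fun x => [set y | l2dist x y < e]).
- by move=> x _; exact: open_l2dist_lt.
- by move=> x Ax; exists x => //=; rewrite l2distxx.
exists (finmap.enum_fset D).
  by move=> y yD; have /set_mem := DA y yD.
by move=> x /AD[y /= yD xy]; exists y => //; rewrite l2dist_sym.
Qed.

End Covering.

(** * Geometric scales and comparison of exponents *)

Section Scales.
Context {R : realType}.

Lemma exprn_lt_small (z t : R) : 0 <= z < 1 -> 0 < t -> exists n, z ^+ n < t.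
Proof.
move=> /andP[z0 z1] t0.
have /cvgrPdist_lt/(_ _ t0)[n _ /(_ n (leqnn n))] :
    z ^+ n @[n --> \oo] --> (0 : R) by apply: cvg_expr; rewrite ger0_norm.
by rewrite /= sub0r normrN ger0_norm ?exprn_ge0// => h; exists n.
Qed.

(** Take the least level of width at most [t]: unless it is 0, the level before it is wider than
    [t]. *)
Lemma exists_scale (lam d t : R) : 0 < lam < 1 -> 0 < d -> 0 < t ->
  exists2 n, d * lam ^+ n <= t & n = 0%N \/ lam * t <= d * lam ^+ n.
Proof.
move=> /andP[l0 l1] d0 t0.
have [|n0 hn0] := @exprn_lt_small lam (t / d) _ (divr_gt0 t0 d0).
  by rewrite ltW.
have ex : exists n, d * lam ^+ n <= t.
  by exists n0; rewrite mulrC -ler_pdivlMr// ltW.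
case: (ex_minnP ex) => -[|n] nt nmin; first by exists 0%N => //; left.
exists n.+1 => //; right; rewrite exprS mulrCA ler_pM2l//.
by rewrite leNgt; apply/negP => /ltW /nmin; rewrite ltnn.
Qed.

(** If [b < a], the powers of [x ^ (b - a) < 1] eventually drop below [C^-1]. *)
Lemma powR_unbounded_exponent (x C a b : R) : 1 < x -> 0 < C ->
  (forall k, (x ^+ k) `^ a <= C * (x ^+ k) `^ b) -> a <= b.
Proof.
move=> x1 C0 h; rewrite leNgt; apply/negP => ba.
have x0 : 0 < x by lra.
pose z := x `^ (b - a).
have zE k : z ^+ k = (x ^+ k) `^ (b - a).
  by rewrite -powR_mulrn ?powR_ge0// -powRrM mulrC powRrM powR_mulrn// ltW.
have z1 : z < 1.
  rewrite /z -opprB powRN invf_lt1 ?powR_gt0// -(powRr0 x) /powR gt_eqF// ltr_expR.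
  by rewrite ltr_pM2r ?ln_gt0// subr_gt0.
have [k hk] : exists k, z ^+ k < C^-1.
  by apply: exprn_lt_small; rewrite ?invr_gt0// powR_ge0.
have := h k; rewrite leNgt => /negP; apply.
have xk : 0 < x ^+ k by rewrite exprn_gt0.
rewrite -(@ltr_pM2r _ ((x ^+ k) `^ (- a))) ?powR_gt0//.
have xkN : x ^+ k != 0 by rewrite gt_eqF.
rewrite -mulrA -!powRD ?xkN ?implybT// -zE subrr powRr0.
by rewrite mulrC -ltr_pdivlMr// mul1r.
Qed.

End Scales.

(** * Dimension of the power of a Cantor set *)

Section CantorProduct.
Context {R : realType} {m : nat} (lam d alpha : R) (c : 'rV[R]_m).
Hypotheses (m_gt0 : (0 < m)%N) (lam_gt0 : 0 < lam) (lam_le_half : 2 * lam <= 1).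
Hypotheses (d_gt0 : 0 < d) (alpha_gt0 : 0 < alpha).
Hypothesis lam_alpha : lam^-1 `^ alpha = 2 ^+ m.

Definition cantor_product : set 'rV[R]_m :=
  [set x | forall i, cantor lam d (c ord0 i) (x ord0 i)].

Let lam_lt1 : lam < 1.
Proof. by have := lam_gt0; have := lam_le_half; lra. Qed.

Lemma cantor_product_compact : compact cantor_product.
Proof.
apply: (@rV_compact R m (fun i => cantor lam d (c ord0 i))) => i.
exact: cantor_compact.
Qed.

Lemma cantor_product_base : cantor_product c.
Proof. by move=> i; exact: cantor_base. Qed.

Lemma cantor_product_close x : cantor_product x -> l2dist c x <= m%:R * d.
Proof.
move=> cx; apply: l2norm_le_coord => [|i]; first exact: ltW.
rewrite !mxE distrC; have /andP[h1 h2] := cantor_le (cx i).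
by rewrite ger0_norm ?subr_ge0// lerBlDl.
Qed.

Lemma powR_scale l : (lam^-1 ^+ l) `^ alpha = ((2 ^ l) ^ m)%:R.
Proof.
have l0 : 0 <= lam^-1 by rewrite invr_ge0 ltW.
rewrite -powR_mulrn// powRAC lam_alpha powR_mulrn ?exprn_ge0//.
by rewrite -expnM mulnC natrX exprM.
Qed.

(** Choose levels [n] and [k] of widths comparable to [s] and [r]. A ball of radius [s] meets at
    most [5 ^ m] cells of level [n], and the corners of their [2 ^ (l * m)] descendants at level
    [k = n + l] serve as centres. *)
Lemma cantor_product_homogeneous : homogeneous alpha cantor_product.
Proof.
(* A cell of width at most [r / M] has Euclidean diameter at most [r / 4], below the required
   [r / 2]. *)
pose M : R := 4 * m%:R.
have m1 : (1 : R) <= m%:R by rewrite ler1n.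
have M1 : 1 <= M by rewrite /M; lra.
have M0 : 0 < M by lra.
(* [C1 * (s / r)] is the quotient of [2 * s / lam], which bounds the width at level [n] from above,
   by [lam * (r / M)], which bounds that at level [k] from below. *)
pose C1 := 2 * M / lam / lam.
have C10 : 0 < C1 by rewrite !divr_gt0// mulr_gt0.
exists (5 ^+ m * C1 `^ alpha); first by rewrite mulr_gt0 ?exprn_gt0 ?powR_gt0.
move=> r s x r0 rs; have s0 : 0 < s := lt_trans r0 rs.
have lam01 : 0 < lam < 1 by rewrite lam_gt0 lam_lt1.
have [k wk hk] := exists_scale lam01 d_gt0 (divr_gt0 r0 M0).
have [N wN hN] := exists_scale lam01 d_gt0 (mulr_gt0 (ltr0Sn R 1) s0).
(* Two points of a ball of radius [s] are at most [2 * s] apart. One level above [N] the width is at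
   least that; for [N = 0] the predecessor is again 0, with a single cell. *)
pose n := N.-1.
have wn_le : d * lam ^+ n <= 2 * s / lam.
  rewrite ler_pdivlMr//; apply: le_trans wN; rewrite /n.
  case: (N) => [|N'] /=; last by rewrite exprSr mulrA.
  by rewrite expr0 mulr1 ler_piMr// ltW.
have wn_ge : n = 0%N \/ 2 * s <= d * lam ^+ n.
  rewrite /n; case: hN => [->|]; first by left.
  by case: (N) => [|N'] h /=; [left|right; rewrite -(ler_pM2l lam_gt0) [leRHS]mulrCA -exprS].
have rM : r / M <= r by rewrite ler_pdivrMr// ler_peMr// ltW.
have nk : (n <= k)%N.
  case: wn_ge => [->//|h]; rewrite leqNgt; apply/negP => /ltnW kn.
  by have := width_le lam_gt0 lam_le_half d_gt0 kn; lra.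
pose l := (k - n)%N; have kE : k = (n + l)%N by rewrite subnKC.
have scale_le : lam^-1 ^+ l <= C1 * (s / r).
  (* For [k = 0] there is no lower bound on the width, but then [l = 0] and both factors on the
     right are at least 1. *)
  case: hk => [k0|hk].
    rewrite /l k0 sub0n expr0 -[leLHS]mulr1 ler_pM//.
      rewrite /C1 ler_pdivlMr// mul1r ler_pdivlMr//.
      have : lam * lam <= 1 * 1 by rewrite ler_pM// ltW.
      by lra.
    by rewrite ler_pdivlMr// mul1r ltW.
  have wk0 := width_gt0 lam_gt0 d_gt0 k.
  have -> : lam^-1 ^+ l = (d * lam ^+ n) / (d * lam ^+ k).
    rewrite kE exprD exprVn; field.
    by rewrite !expf_neq0 ?gt_eqF.
  rewrite ler_pdivrMr//; apply: le_trans wn_le _.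
  have -> : 2 * s / lam = C1 * (s / r) * (lam * (r / M)).
    by rewrite /C1; field; rewrite !gt_eqF.
  by rewrite ler_pM2l// mulr_gt0// divr_gt0.
have count_le : ((5 * 2 ^ l) ^ m)%:R <= 5 ^+ m * C1 `^ alpha * (s / r) `^ alpha.
  rewrite expnMn natrM natrX -powR_scale -mulrA ler_pM2l ?exprn_gt0//.
  have sr0 : 0 <= s / r by rewrite divr_ge0// ltW.
  rewrite -powRM ?(ltW C10)//.
  have li0 : 0 <= lam^-1 by rewrite invr_ge0 ltW.
  apply: ge0_ler_powR; rewrite ?nnegrE ?exprn_ge0 //; first exact: ltW.
  by rewrite mulr_ge0 // ltW.
(* The centre [x] may lie outside the set, so the cover is anchored at some point [y0] of the set in
   the ball; without one, the empty list suffices. *)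
have [[y0 [y0A y0x]]|none] :=
    pselect (exists y, cantor_product y /\ l2dist y x <= s); last first.
  exists [::]; last by rewrite !mulr_ge0 ?exprn_ge0 ?powR_ge0.
  by move=> y yA yx; exfalso; apply: none; exists y.
have /choice[j0 hj0] := fun i =>
  cantor_local_cover lam_gt0 lam_le_half d_gt0 n l (y0A i).
pose centre (J : {ffun 'I_m -> 'I_5 * 'I_(2 ^ l)}) : 'rV[R]_m :=
  \row_i (c ord0 i + node lam d k ((j0 i + (J i).1 - 2) * 2 ^ l + (J i).2)%N).
exists [seq centre J | J <- enum {ffun 'I_m -> 'I_5 * 'I_(2 ^ l)}]; last first.
  by rewrite size_map -cardE card_ffun card_prod !card_ord.
move=> y yA yx.
have /choice[J hJ] : forall i, exists v : 'I_5 * 'I_(2 ^ l),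
    `|c ord0 i + node lam d k ((j0 i + v.1 - 2) * 2 ^ l + v.2)%N - y ord0 i|
      <= d * lam ^+ k.
  move=> i; rewrite kE; apply: hj0; first exact: yA.
  case: wn_ge => [->|wn_ge]; [by left|right; apply: le_trans wn_ge].
  have /= := coord_le_l2norm (y0 - y) i; rewrite !mxE => /le_trans; apply.
  rewrite -/(l2dist y0 y) (le_trans (l2dist_triangle x _ _))//.
  by rewrite (l2dist_sym x); lra.
exists (centre [ffun i => J i]); first by rewrite map_f// mem_enum.
have wk0 := width_gt0 lam_gt0 d_gt0 k.
apply: (@le_lt_trans _ _ (m%:R * (d * lam ^+ k))).
  by apply: l2norm_le_coord => [|i]; [exact: ltW | rewrite !mxE ffunE].
have : M * (d * lam ^+ k) <= r by rewrite mulrC -ler_pdivlMr.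
have : 0 < m%:R * (d * lam ^+ k) by rewrite mulr_gt0// ltr0n.
by rewrite /M -mulrA; lra.
Qed.

Lemma cantor_product_assouad_dim_ge : (alpha%:E <= assouad_dim cantor_product)%E.
Proof.
apply: le_ereal_inf_tmp => _ [b [b0 [C C0 hC]] <-]; rewrite lee_fin.
have m1 : (1 : R) <= m%:R by rewrite ler1n.
(* The ball of this radius around [c] contains the whole product, by [cantor_product_close]. *)
pose s := (m%:R + 1) * d.
have s0 : 0 < s by rewrite mulr_gt0// ltr_wpDl.
apply: (@powR_unbounded_exponent _ lam^-1 (C * (2 * (m%:R + 1)) `^ b)).
- by rewrite invf_gt1.
- by rewrite mulr_gt0// powR_gt0// mulr_gt0// ltr_wpDl.
move=> k; rewrite powR_scale.
have wk0 := width_gt0 lam_gt0 d_gt0 k.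
(* Halving turns the separation by at least one width into the strict inequality that
   [covering_number_ge] asks for. *)
pose r := d * lam ^+ k / 2.
have r0 : 0 < r by rewrite divr_gt0.
have wr : r < d * lam ^+ k by rewrite /r; lra.
have wd : d * lam ^+ k <= d.
  by have := width_le lam_gt0 lam_le_half d_gt0 (leq0n k); rewrite expr0 mulr1.
have ds : d <= s by rewrite /s ler_peMl ?(ltW d_gt0)//; lra.
have rs : r < s by apply: lt_le_trans wr _; exact: le_trans ds.
have sr : s / r = 2 * (m%:R + 1) * lam^-1 ^+ k.
  rewrite /s /r exprVn; field.
  by rewrite !expf_neq0 ?gt_eqF.
have lk0 : 0 <= lam^-1 ^+ k by rewrite exprn_ge0// invr_ge0 ltW.
have m2 : 0 <= 2 * (m%:R + 1) :> R by lra.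
rewrite -mulrA -powRM// -sr -lee_fin.
apply: le_trans (hC r s r0 rs c cantor_product_base).
pose q (J : {ffun 'I_m -> 'I_(2 ^ k)}) : 'rV[R]_m :=
  \row_i (c ord0 i + node lam d k (J i)).
have -> : ((2 ^ k) ^ m)%N = #|{ffun 'I_m -> 'I_(2 ^ k)}|.
  by rewrite card_ffun !card_ord.
have qA J : cantor_product (q J).
  by move=> i; rewrite mxE; exact: cantor_node.
apply: (@covering_number_ge _ _ _ _ _ q) => [J|J J' JJ'].
  split; last exact: qA.
  rewrite /l2ball /= l2dist_sym (le_trans (cantor_product_close (qA J)))//.
  by rewrite /s mulrDl mul1r lerDl ltW.
have [i iJ] : exists i, J i != J' i.
  apply/existsP; rewrite -negb_forall; apply: contra JJ' => /forallP h.
  by apply/eqP/ffunP => i; exact/eqP.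
apply: lt_le_trans wr _.
have := coord_le_l2norm (q J - q J') i; apply: le_trans.
rewrite !mxE opprD addrACA subrr add0r; exact: node_sep.
Qed.

End CantorProduct.

(** * Small sets of prescribed dimension, and density *)

Lemma exists_small_homogeneous (R : realType) (m : nat) (alpha e : R)
    (c : 'rV[R]_m) : (0 < m)%N -> 0 <= alpha <= m%:R -> 0 < e ->
  exists A : set 'rV[R]_m, [/\ compact A, A c, forall x, A x -> l2dist c x <= e,
    homogeneous alpha A & (alpha%:E <= assouad_dim A)%E].
Proof.
move=> m0 /andP[a0 am] e0; have m0R : (0 : R) < m%:R by rewrite ltr0n.
(* At [alpha = 0] the ratio would involve a division by zero, so a singleton is used. *)
move: a0; rewrite le_eqVlt => /predU1P[<-|a0].
  exists [set` [:: c]]; split.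
  - exact/finite_compact/finite_seq.
  - by rewrite /= inE.
  - by move=> x; rewrite /= inE => /eqP ->; rewrite l2distxx ltW.
  - exact: homogeneous_seq.
  - exact: assouad_dim_ge0.
pose lam : R := 2 `^ (- (m%:R / alpha)).
have lam0 : 0 < lam by rewrite powR_gt0.
have lam2 : 2 * lam <= 1.
  rewrite /lam powRN ler_pdivrMr ?powR_gt0// mul1r -[leLHS]powRr1//.
  by apply: ler_powR; [lra | rewrite ler_pdivlMr// mul1r].
have lamE : lam^-1 `^ alpha = 2 ^+ m.
  by rewrite /lam powRN invrK -powRrM divfK ?gt_eqF// powR_mulrn.
(* With side [e / m], the bound [m * d] of [cantor_product_close] becomes [e]. *)
have d0 : 0 < e / m%:R by rewrite divr_gt0.
exists (cantor_product lam (e / m%:R) c); split.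
- exact: cantor_product_compact.
- exact: cantor_product_base.
- move=> x /(cantor_product_close d0).
  by rewrite mulrCA divff ?gt_eqF// mulr1.
- exact: cantor_product_homogeneous.
- exact: cantor_product_assouad_dim_ge.
Qed.

Theorem theorem3p10 (R : realType) (m : nat) (hm : (1 <= m)%N)
    (alpha : R) (halpha : 0 <= alpha <= m%:R) :
  dense [set E : compacts R m | assouad_dim E = alpha%:E].
Proof.
move=> O [K OK] Oop; have /andP[a0 _] := halpha.
have : nbhs K O by apply: open_nbhs_nbhs.
move=> /nbhs_ballP[e /= e0 KO].
have e2 : 0 < e / 2 by rewrite divr_gt0.
have [u uK Ku] := compact_finite_net (compacts_compact (c := K)) e2.
have [c Kc] := compacts_neq0 K.
have [A [cA Ac Ae Ahom Adim]] := exists_small_homogeneous c hm halpha e2.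
have cE : compact ([set` u] `|` A).
  by apply: compactU => //; exact/finite_compact/finite_seq.
have E0 : [set` u] `|` A !=set0 by exists c; right.
exists (Compacts cE E0); split; last first.
  (* The upper bound comes from homogeneity of the union, the lower one from monotonicity, since [A]
     is a subset. *)
  rewrite /=; apply/eqP; rewrite eq_le; apply/andP; split.
    apply: homogeneous_assouad_dim_le => //; apply: homogeneousU => //.
    exact: homogeneous_seq.
  by apply: le_trans Adim _; apply: assouad_dim_sub => x; right.
apply: KO; rewrite ballEmdist /=.
suff : hausdorff_dist K (Compacts cE E0) <= e / 2.
  by move=> /le_lt_trans; apply; lra.
rewrite /hausdorff_dist ge_max; apply/andP; split; apply: excess_le => x.
  move=> /Ku[y yu xy]; apply: le_trans (ltW xy).
  by apply: infdist_le; left.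
(* Net points lie in [K], and points of [A] are within [e / 2] of [c], which lies in [K]. *)
move=> [xu|Ax].
  by rewrite (le_trans (infdist_le _ (uK _ xu)))// l2distxx ltW.
by rewrite (le_trans (infdist_le _ Kc))// l2dist_sym; exact: Ae.
Qed.
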